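(* Let $a,b,c,d\in\mathbb{R}$ with $a,b,c$ not all zero, and let $P=\{(x,y,z)\in\mathbb{R}^3 : ax+by+cz=d\}$ be the corresponding plane, with the metric induced from $(\mathbb{R}^3,d_\infty)$. (i) If the numbers $|a|,|b|,|c|$ are not the lengths of the edges of a non-degenerate triangle, then $P$ is isometric to $(\mathbb{R}^2,d_\infty)$; hence all such planes are isometric to each other. (ii) If the numbers $|a|,|b|,|c|$ are the lengths of the edges of a non-degenerate triangle, then $P$ is isometric only to planes in $(\mathbb{R}^3,d_\infty)$ whose equations can be written as $aw_1+bw_2+cw_3=D$, where $\{w_1,w_2,w_3\}=\{\pm x,\pm y,\pm z\}$ (that is, $w_1,w_2,w_3$ are $x,y,z$ in some order, each with some choice of sign) and $D$ is any real number.
   Context: $d_\infty$ denotes the maximum metric $d_\infty(u,v)=\max_k|u_k-v_k|$ on $\mathbb{R}^n$. All planes in $\mathbb{R}^3$ carry the metric induced from $(\mathbb{R}^3,d_\infty)$. An isometry between metric spaces $(X,d_X)$ and $(Y,d_Y)$ is a map $f$ from $X$ onto $Y$ with $d_Y(f(x),f(y))=d_X(x,y)$ for all $x,y\in X$; two metric spaces are isometric if there is an isometry between them. The numbers $|a|,|b|,|c|$ are the lengths of the edges of a non-degenerate triangle when $|a|,|b|,|c|\neq0$, $|a|+|b|>|c|$, $|a|+|c|>|b|$ and $|b|+|c|>|a|$. *)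

(* Defs.v *)
From HB Require Import structures.
From mathcomp Require Import all_boot all_order all_algebra all_fingroup.
From mathcomp Require Import all_classical all_reals all_analysis.

Set Implicit Arguments.
Unset Strict Implicit.
Unset Printing Implicit Defensive.

Import Order.TTheory GRing.Theory Num.Theory.
Import numFieldNormedType.Exports.

Local Open Scope classical_set_scope.
Local Open Scope ring_scope.

(* The norm that MathComp-Analysis puts on row vectors is the maximum norm, so
   the distance `|u - v| on 'rV[R]_n is d_oo. *)
Lemma row_distE (R : realType) (n : nat) (u v : 'rV[R]_n) :
  `|u - v| = \big[Num.max/0]_(k < n) `|u 0 k - v 0 k|.
Proof.
rewrite [LHS]/Num.Def.normr /= mx_normrE.
apply/eqP; rewrite eq_le; apply/andP; split; apply/bigmax_leP; split.
- exact: bigmax_ge_id.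
- move=> [i k] _ /=; rewrite !mxE (ord1 i).
  exact: (le_bigmax _ (fun k => `|u 0 k - v 0 k|) k).
- exact: bigmax_ge_id.
- move=> k _; have -> : `|u 0 k - v 0 k| = `|(u - v) 0 k| by rewrite !mxE.
  exact: (le_bigmax _ (fun ij : 'I_1 * 'I_n => `|(u - v) ij.1 ij.2|) (0, k)).
Qed.

(* Subsets carry the induced metric, so only the values of f on A matter. *)
Definition isometric (R : realType) (V W : normedModType R)
    (A : set V) (B : set W) : Prop :=
  exists f : V -> W,
    f @` A = B /\ forall x y, A x -> A y -> `|f x - f y| = `|x - y|.

Definition plane (R : realType) (a b c d : R) : set 'rV[R]_3 :=
  [set p | a * p 0 0 + b * p 0 1 + c * p 0 2 = d].

Definition triangle_sides (R : realType) (x y z : R) : Prop :=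
  [/\ x != 0, y != 0 & z != 0] /\ [/\ x + y > z, x + z > y & y + z > x].

(* The triple (w_1, w_2, w_3) obtained from the coordinates (x, y, z) of p by
   reordering them along s and giving the i-th term the sign (-1) ^ (e i). *)
Definition signed_perm (R : realType) (s : 'S_3) (e : 'I_3 -> bool)
    (p : 'rV[R]_3) : 'rV[R]_3 :=
  \row_i ((-1) ^+ e i * p 0 (s i)).

(* Main.v *)
Require Import Defs.
From HB Require Import structures.
From mathcomp Require Import all_boot all_order all_algebra all_fingroup.
From mathcomp Require Import all_classical all_reals all_analysis.
From mathcomp Require Import lra.

(** Both parts hold for hyperplanes
    [al_1 x_1 + ... + al_n x_n = d] of (R^n, d_oo), and are proved there; the
    triangle condition is the case n = 3 of the polygon condition that every
    [|al_i|] is less than the sum of the other [|al_j|].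

    If some nonzero [|al_i|] is at least the sum of the others, the equation
    bounds the variation of [x_i] by that of the other coordinates, so that
    forgetting [x_i] is an isometry onto R^(n-1)
    ([isometric_drop_coord]).

    If the polygon condition holds, the hyperplane has, for each [i], a
    direction [u] with [u_i = 1] and [|u_j| < 1] for all other [j]
    ([exists_peaked]).  For such a [u] and any [v], the number [t - |v - t u|]
    is at least [v_i] as soon as [t] is large ([peaked_ray]): the coordinate
    [x_i] is a Busemann function of the line along [u], hence is visible to
    the metric.  A distance-preserving [f] sends this line to a geodesic line
    of (R^n, d_oo), and along such a line some signed coordinate grows at unit
    speed ([geodesic_line_coord]).  Comparing the two, [x_i] and this signed
    coordinate of [f] differ by a constant on the whole hyperplane
    ([isometry_coord]).  Distinct [i] give distinct coordinates of [f], so [f]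
    is, up to a translation, a signed permutation of the coordinates, and the
    image of [f] has the announced equation
    ([isometric_polygonal_hyperplane]).

    Conversely, signed permutations and translations are isometries
    ([isometric_signed_coords]). *)

Set Implicit Arguments.
Unset Strict Implicit.
Unset Printing Implicit Defensive.

Import Order.TTheory GRing.Theory Num.Theory.
Import numFieldNormedType.Exports.

Local Open Scope classical_set_scope.
Local Open Scope ring_scope.

(** * The maximum norm on row vectors *)

Lemma row_norm_leP (R : realType) (n : nat) (u : 'rV[R]_n) (x : R) :
  reflect (0 <= x /\ forall k, `|u 0 k| <= x) (`|u| <= x).
Proof.
rewrite -[u in `|u|]subr0 row_distE.
apply: (iffP idP) => [/bigmax_leP[x0 ux]|[x0 ux]].
  by split=> // k; have := ux k isT; rewrite !mxE subr0.
by apply/bigmax_leP; split=> // k _; have := ux k; rewrite !mxE subr0.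
Qed.

Lemma coord_le_norm (R : realType) (n : nat) (u : 'rV[R]_n) (k : 'I_n) :
  `|u 0 k| <= `|u|.
Proof. by have [_ +] := row_norm_leP _ _ (lexx `|u|); apply. Qed.

Lemma signed_coord_le_norm (R : realType) (n : nat) (u : 'rV[R]_n) (k : 'I_n)
    (e : bool) : (-1) ^+ e * u 0 k <= `|u|.
Proof.
apply: le_trans (coord_le_norm u k).
by apply: le_trans (ler_norm _) _; rewrite normrM normr_sign mul1r.
Qed.

Lemma norm_signed_coord (R : realType) (n : nat) (u : 'rV[R]_n.+1) :
  exists k e, `|u| = (-1) ^+ (e : bool) * u 0 k.
Proof.
have [k uk] : exists k, `|u 0 k| = `|u|.
  have [k _ kmax] := @arg_maxP _ _ _ ord0 xpredT (fun k => `|u 0 k|) isT.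
  exists k; apply/eqP; rewrite eq_le coord_le_norm /=.
  by apply/row_norm_leP; split=> // j; apply: kmax.
by exists k, (u 0 k < 0)%R; rewrite -uk normrEsign.
Qed.

(** * Isometry of subsets as an equivalence relation *)

Section Isometric.
Variables (R : realType) (U V W : normedModType R).

Lemma isometric_sym (A : set U) (B : set V) : isometric A B -> isometric B A.
Proof.
case=> f [<- fA].
have /choice[g gP] : forall y, exists x, (f @` A) y -> A x /\ f x = y.
  by move=> y; case: (pselect ((f @` A) y)) => [[x Ax <-]|]; [exists x|exists 0].
have gK x : A x -> g (f x) = x.
  move=> Ax; have [|Agfx fgfx] := gP (f x); first by exists x.
  by apply/eqP; rewrite -subr_eq0 -normr_eq0 -fA // fgfx subrr normr0.
exists g; split; last by move=> _ _ [x Ax <-] [y Ay <-]; rewrite !gK // fA.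
apply/seteqP; split=> [_ [_ [x Ax <-] <-]|x Ax]; first by rewrite gK.
by exists (f x); [exists x | exact: gK].
Qed.

Lemma isometric_trans (A : set U) (B : set V) (C : set W) :
  isometric A B -> isometric B C -> isometric A C.
Proof.
move=> [f [<- fA]] [g [<- gB]]; exists (g \o f); split; first by rewrite image_comp.
by move=> x y Ax Ay /=; rewrite gB ?fA //; exact: imageP.
Qed.

End Isometric.

(** * Hyperplanes *)

Definition hyperplane (R : realType) (n : nat) (al : 'I_n -> R) (d : R) :
    set 'rV[R]_n :=
  [set p | \sum_i al i * p 0 i = d].

Section Hyperplane.
Variables (R : realType) (n : nat) (al : 'I_n -> R).
Implicit Types (c d t : R) (p q : 'rV[R]_n).

Lemma hyperplaneD c d p q :
  hyperplane al c p -> hyperplane al d q -> hyperplane al (c + d) (p + q).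
Proof.
rewrite /hyperplane /= => <- <-; rewrite -big_split /=.
by apply: eq_bigr => i _; rewrite mxE mulrDr.
Qed.

Lemma hyperplaneB c d p q :
  hyperplane al c p -> hyperplane al d q -> hyperplane al (c - d) (p - q).
Proof.
rewrite /hyperplane /= => <- <-; rewrite -sumrB.
by apply: eq_bigr => i _; rewrite !mxE mulrBr.
Qed.

Lemma hyperplane0Z t p : hyperplane al 0 p -> hyperplane al 0 (t *: p).
Proof.
rewrite /hyperplane /= => p0; under eq_bigr do rewrite mxE mulrCA.
by rewrite -mulr_sumr p0 mulr0.
Qed.

Lemma hyperplane_point d i : al i != 0 -> exists p, hyperplane al d p.
Proof.
move=> ai0; exists (\row_j if j == i then d / al i else 0).
rewrite /hyperplane /= (bigD1 i) //= big1 => [|j /negbTE ji].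
  by rewrite mxE eqxx addr0 mulrC divfK.
by rewrite mxE ji mulr0.
Qed.

End Hyperplane.

Definition polygon_sides (R : realType) (n : nat) (al : 'I_n -> R) : Prop :=
  forall i, `|al i| < \sum_(j | j != i) `|al j|.

(** On the direction space, [|al i| |v_i| <= sum |al j| |v_j| <= |al i| max |v_j|]
    over the other indices [j]: the dropped coordinate never decides the
    norm.  It is recovered from the others by solving the equation, which
    gives surjectivity. *)
Lemma isometric_drop_coord (R : realType) (n : nat) (al : 'I_n.+1 -> R)
    (d : R) (i : 'I_n.+1) :
  al i != 0 -> \sum_(j | j != i) `|al j| <= `|al i| ->
  isometric (hyperplane al d) [set: 'rV[R]_n].
Proof.
move=> ai0; rewrite big_mkcond (bigD1_ord i) //= eqxx add0r.
under eq_bigr do rewrite eq_sym neq_lift.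
move=> dom.
exists (fun p : 'rV[R]_n.+1 => \row_j p 0 (lift i j)); split.
  apply/seteqP; split=> // q _.
  pose z := (d - \sum_j al (lift i j) * q 0 j) / al i.
  exists (\row_k oapp (q 0) z (unlift i k)).
    rewrite /hyperplane /= (bigD1_ord i) //= mxE unlift_none /=.
    under eq_bigr do rewrite mxE liftK /=.
    by rewrite /z mulrC divfK // subrK.
  by apply/rowP => j; rewrite !mxE liftK.
move=> x y Px Py; apply/eqP; rewrite eq_le; apply/andP; split.
  apply/row_norm_leP; split=> // j.
  by have := coord_le_norm (x - y) (lift i j); rewrite !mxE.
set w := (X in _ <= `|X|); apply/row_norm_leP; split=> // k.
have wE j : (x - y) 0 (lift i j) = w 0 j by rewrite !mxE.
case: (unliftP i k) => [j ->|->]; first by rewrite wE coord_le_norm.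
have : al i * (x - y) 0 i = - \sum_j al (lift i j) * w 0 j.
  have := hyperplaneB Px Py; rewrite subrr /hyperplane /=.
  rewrite (bigD1_ord i) //= => /eqP; rewrite addr_eq0 => /eqP ->.
  by under eq_bigr do rewrite wE.
move=> /(congr1 Num.norm); rewrite normrN normrM => E.
rewrite -(ler_pM2l (_ : 0 < `|al i|)) ?normr_gt0 // E.
apply: le_trans (ler_norm_sum _ _ _) _.
apply: le_trans (ler_wpM2r (normr_ge0 w) dom); rewrite mulr_suml.
by apply: ler_sum => j _; rewrite normrM ler_wpM2l // coord_le_norm.
Qed.

(** * Peaked directions *)

(** A peaked direction points into the relative interior of the facet
    [x_i = 1] of the unit cube. *)
Definition peaked (R : realType) (n : nat) (i : 'I_n) (u : 'rV[R]_n) : Prop :=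
  u 0 i = 1 /\ forall j, j != i -> `|u 0 j| < 1.

Lemma exists_peaked (R : realType) (n : nat) (al : 'I_n -> R) (i : 'I_n) :
  `|al i| < \sum_(j | j != i) `|al j| ->
  exists2 u : 'rV[R]_n, hyperplane al 0 u & peaked i u.
Proof.
set S := \sum_(j | _) _ => aiS.
have S0 : 0 < S by apply: le_lt_trans aiS.
(* Spread the compensation for [x_i = 1] evenly, with the signs that make every
   term [al j * u_j] equal to [|al j|] times the same constant; all the other
   coordinates then have size [|al i| / S] or vanish. *)
exists (\row_j if j == i then 1 else - (Num.sg (al j) * (al i / S))).
  rewrite /hyperplane /= (bigD1 i) //= mxE eqxx mulr1.
  rewrite (eq_bigr (fun j => `|al j| * - (al i / S))); last first.
    by move=> j /negbTE ji; rewrite mxE ji !mulrN mulrA [al j * _]mulrC -normrEsg.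
  by rewrite -mulr_suml -/S mulrN mulrCA divff ?gt_eqF // mulr1 subrr.
split=> [|j ji]; rewrite !mxE ?eqxx // (negbTE ji) normrN !normrM.
rewrite normfV (gtr0_norm S0); apply: (@le_lt_trans _ _ (`|al i| / S)).
  rewrite ler_piMl ?divr_ge0 ?(ltW S0) //.
  by rewrite normr_sg; case: (_ != _).
by rewrite ltr_pdivrMr // mul1r.
Qed.

(** Far along a peaked ray the coordinate [i] alone decides the distance to
    [v].  The bound suffices, since [t - v_i] is that coordinate of
    [t u - v], hence a lower bound for the norm. *)
Lemma peaked_ray (R : realType) (n : nat) (i : 'I_n) (u v : 'rV[R]_n) :
  peaked i u -> exists t, `|v - t *: u| <= t - v 0 i.
Proof.
move=> [ui uj].
(* Beyond [c j], the gap [t (1 - |u_j|)] absorbs the contributions of [v] to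
   the coordinates [i] and [j]. *)
pose c j := 2 * `|v| / (1 - `|u 0 j|).
have c0 j : j != i -> 0 <= c j.
  by move=> /uj ?; rewrite divr_ge0 ?mulr_ge0 // subr_ge0 ltW.
pose t := `|v| + \sum_(j | j != i) c j.
have tv : `|v| <= t by rewrite lerDl sumr_ge0.
have tc j : j != i -> c j <= t.
  move=> ji; rewrite /t (bigD1 j) //= addrCA lerDl addr_ge0 // sumr_ge0 //.
  by move=> k /andP[/c0].
have vle k : `|v 0 k| <= `|v| by exact: coord_le_norm.
have tvi : 0 <= t - v 0 i.
  by rewrite subr_ge0; apply: le_trans tv; apply: le_trans (ler_norm _) (vle i).
exists t; apply/row_norm_leP; split=> // j; rewrite !mxE.
have [->|ji] := eqVneq j i; first by rewrite ui mulr1 distrC ger0_norm.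
have t0 : 0 <= t by apply: le_trans tv.
have h : 2 * `|v| <= t * (1 - `|u 0 j|).
  by rewrite -ler_pdivrMr ?subr_gt0 ?uj //; exact: tc.
apply: le_trans (ler_normB _ _) _; rewrite normrM (ger0_norm t0).
have := vle j; have := le_trans (ler_norm _) (vle i); lra.
Qed.

(** * Distance-preserving maps read in coordinates *)

(** On a segment from [- T] to [T], the signed coordinate that attains the
    distance between the two end points has to grow at unit speed all the way, because
    no coordinate can grow faster.  There are finitely many signed coordinates
    and the segments are nested, so one of them works for every [T]. *)
Lemma geodesic_line_coord (R : realType) (m : nat) (g : R -> 'rV[R]_m.+1) :
  (forall s t, `|g s - g t| = `|s - t|) ->
  exists k e, forall t, (-1) ^+ (e : bool) * (g t - g 0) 0 k = t.
Proof.
move=> gi.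
have seg T : 0 <= T -> exists k e, forall t, `|t| <= T ->
    (-1) ^+ (e : bool) * (g t - g 0) 0 k = t.
  move=> T0; have [k [e kE]] := norm_signed_coord (g T - g (- T)).
  exists k, e => t; rewrite ler_norml => /andP[tT Tt].
  (* No signed coordinate grows faster than unit speed. *)
  have L s s' : s' <= s -> (-1) ^+ e * g s 0 k - (-1) ^+ e * g s' 0 k <= s - s'.
    move=> ss'; have := signed_coord_le_norm (g s - g s') k e.
    by rewrite gi ger0_norm ?subr_ge0 // !mxE mulrBr.
  move: kE; rewrite gi !mxE ger0_norm; last by lra.
  rewrite !mulrBr => kE.
  have := L _ _ Tt; have := L _ _ tT; have := L _ _ T0.
  have : - T <= 0 by lra.
  by move=> /L; lra.
apply: contrapT => none.
(* Otherwise each signed coordinate fails at some [T ke]; none of them can then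
   serve the segment that contains all these points. *)
have /choice[T TP] : forall ke : 'I_m.+1 * bool, exists t,
    (-1) ^+ ke.2 * (g t - g 0) 0 ke.1 <> t.
  move=> [k e]; apply: contrapT => all; apply: none; exists k, e => t.
  by apply: contrapT => tP; apply: all; exists t.
have [|k [e ke]] := seg (\sum_ke `|T ke|); first exact: sumr_ge0.
apply: (TP (k, e)); apply: ke.
by rewrite (bigD1 (k, e)) //= lerDl sumr_ge0.
Qed.

(** The triangle inequality with the far point [f (p0 + t u)] bounds the growth
    of the signed coordinate [k] between [f p0] and [f p] from below, by the
    Busemann estimate of [peaked_ray]; the opposite ray bounds it from
    above. *)
Lemma isometry_coord (R : realType) (n m : nat) (A : set 'rV[R]_n)
    (f : 'rV[R]_n -> 'rV[R]_m.+1) (i : 'I_n) (u p0 : 'rV[R]_n) :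
  (forall x y, A x -> A y -> `|f x - f y| = `|x - y|) ->
  peaked i u -> (forall t, A (p0 + t *: u)) ->
  exists k e, forall p, A p ->
    (-1) ^+ (e : bool) * (f p - f p0) 0 k = (p - p0) 0 i.
Proof.
move=> fA pu Au.
have u1 : `|u| = 1.
  apply/eqP; rewrite eq_le; apply/andP; split; last first.
    by rewrite -[1]normr1 -pu.1 coord_le_norm.
  apply/row_norm_leP; split=> // j.
  have [->|/pu.2/ltW//] := eqVneq j i; by rewrite pu.1 normr1.
have [|k [e ke]] := @geodesic_line_coord R m (fun t => f (p0 + t *: u)).
  move=> s t; rewrite fA // opprD addrACA subrr add0r -scalerBl.
  by rewrite normrZ u1 mulr1.
exists k, e => p Ap; rewrite scale0r addr0 in ke.
(* [b] selects the ray: [u] for [false], [- u] for [true]. *)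
have half (b : bool) : (-1) ^+ b * (p - p0) 0 i <=
    (-1) ^+ b * ((-1) ^+ e * (f p - f p0) 0 k).
  have [t] := peaked_ray ((-1) ^+ b *: (p - p0)) pu.
  pose s := (-1) ^+ b * t.
  have tE : t = (-1) ^+ b * s by rewrite mulrA -expr2 sqrr_sign mul1r.
  have -> : `|(-1) ^+ b *: (p - p0) - t *: u| = `|f (p0 + s *: u) - f p|.
    rewrite [RHS]distrC fA // opprD addrA [in LHS]tE.
    by rewrite -scalerA -scalerBr normrZ normr_sign mul1r.
  have := signed_coord_le_norm (f (p0 + s *: u) - f p) k (b (+) e).
  have := ke s; rewrite signr_addb !mxE -mulrA.
  move=> ks h1; rewrite [X in _ <= X - _ -> _]tE => h2; have := le_trans h1 h2.
  have -> : (-1) ^+ e * (f (p0 + s *: u) 0 k - f p 0 k) =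
    s - (-1) ^+ e * (f p 0 k - f p0 0 k) by move: ks; rewrite !mulrBr; lra.
  by rewrite !mulrBr; lra.
have := half false; have := half true; rewrite expr0 expr1 !mul1r !mulN1r.
by move=> h1 h2; apply/eqP; rewrite eq_le h2 -lerN2 h1.
Qed.

(** * Signed permutations of the coordinates *)

Definition signed_coords (R : realType) (n : nat) (s : 'S_n)
    (e : 'I_n -> bool) (q : 'rV[R]_n) : 'rV[R]_n :=
  \row_i ((-1) ^+ e i * q 0 (s i)).

Section SignedCoords.
Variables (R : realType) (n : nat) (s : 'S_n) (e : 'I_n -> bool).
Implicit Types q p : 'rV[R]_n.

Lemma signed_coordsB q q' :
  signed_coords s e (q - q') = signed_coords s e q - signed_coords s e q'.
Proof. by apply/rowP => i; rewrite !mxE mulrBr. Qed.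

Lemma norm_signed_coords q : `|signed_coords s e q| = `|q|.
Proof.
apply/eqP; rewrite eq_le; apply/andP; split; apply/row_norm_leP; split=> // k.
  by rewrite mxE normrM normr_sign mul1r coord_le_norm.
have := coord_le_norm (signed_coords s e q) ((s^-1)%g k).
by rewrite mxE permKV normrM normr_sign mul1r.
Qed.

Lemma signed_coords_inj : injective (@signed_coords R n s e).
Proof.
move=> q q' qq'; apply/eqP; rewrite -subr_eq0 -normr_eq0.
by rewrite -norm_signed_coords signed_coordsB qq' subrr normr0.
Qed.

Lemma signed_coords_surj p : exists q, signed_coords s e q = p.
Proof.
exists (\row_j ((-1) ^+ e ((s^-1)%g j) * p 0 ((s^-1)%g j))).
by apply/rowP => i; rewrite !mxE permK mulrA -expr2 sqrr_sign mul1r.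
Qed.

End SignedCoords.

(** * Hyperplanes satisfying the polygon condition *)

(** By [isometry_coord], applied to each coordinate in turn, the isometry is a
    translation followed by the inverse of a signed permutation, and [B] is
    its image. *)
Lemma isometric_polygonal_hyperplane (R : realType) (n : nat)
    (al : 'I_n.+1 -> R) (d : R) (p0 : 'rV[R]_n.+1) (B : set 'rV[R]_n.+1) :
  polygon_sides al -> hyperplane al d p0 -> isometric (hyperplane al d) B ->
  exists (s : 'S_n.+1) (e : 'I_n.+1 -> bool) (D : R),
    B = signed_coords s e @^-1` hyperplane al D.
Proof.
move=> poly Pp0 [f [<- fP]].
set P := hyperplane al d in Pp0 fP *.
have /choice[s /choice[e se]] : forall i, exists k e, forall p, P p ->
    (-1) ^+ (e : bool) * (f p - f p0) 0 k = (p - p0) 0 i.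
  move=> i; have [u u0 pu] := exists_peaked (poly i).
  apply: (isometry_coord fP pu) => t.
  by rewrite /P -[d]addr0; apply: hyperplaneD Pp0 (hyperplane0Z t u0).
(* If coordinates [i] and [j] were both read off the coordinate [s i] of [f],
   they would have equal variation in absolute value along any direction,
   contrary to the existence of one peaked at [i]. *)
have s_inj : injective s.
  move=> i j sij; apply/eqP; apply: contrapT => /negP ij.
  have [u u0 [ui uj]] := exists_peaked (poly i).
  have Pu : P (p0 + u) by rewrite /P -[d]addr0; apply: hyperplaneD.
  have := uj j; rewrite eq_sym => /(_ ij).
  have := se i _ Pu; have := se j _ Pu; rewrite addrAC subrr add0r sij.
  move=> <- /(congr1 Num.norm).
  by rewrite ui !normrM !normr_sign normr1 => ->; rewrite ltxx.
pose w := @signed_coords R _ (perm s_inj) e.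
have wf p : P p -> w (f p) = w (f p0) + (p - p0).
  move=> Pp; apply/eqP; rewrite addrC -subr_eq -signed_coordsB; apply/eqP.
  by apply/rowP => i; rewrite mxE permE se.
pose D := \sum_i al i * w (f p0) 0 i.
have w0 : hyperplane al D (w (f p0)) by [].
exists (perm s_inj), e, D; apply/seteqP; split=> [_ [p Pp <-]|q Lq].
  have := hyperplaneD w0 (hyperplaneB Pp Pp0).
  by rewrite subrr addr0 -wf.
have Pq : P (p0 + (w q - w (f p0))).
  rewrite /P -[d]addr0; apply: hyperplaneD => //.
  by rewrite -(subrr D); apply: hyperplaneB.
exists (p0 + (w q - w (f p0))) => //; apply: (@signed_coords_inj _ _ (perm s_inj) e).
by rewrite -/w wf // [p0 + _]addrC addrK addrC subrK.
Qed.

(** The translation by [v] adjusts the constant term from [D] to [d]. *)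
Lemma isometric_signed_coords (R : realType) (n : nat) (al : 'I_n -> R)
    (d D : R) (s : 'S_n) (e : 'I_n -> bool) (i : 'I_n) :
  al i != 0 ->
  isometric (hyperplane al d) (signed_coords s e @^-1` hyperplane al D).
Proof.
move=> ai0; apply: isometric_sym.
have [v vP] := hyperplane_point (D - d) ai0.
exists (fun q => signed_coords s e q - v); split; last first.
  by move=> x y _ _; rewrite opprB addrA subrK -signed_coordsB norm_signed_coords.
apply/seteqP; split=> [_ [q /= qD <-]|p pd].
  by rewrite -[d](subKr D); apply: hyperplaneB.
have [q qE] := signed_coords_surj s e (p + v).
exists q; last by rewrite qE addrK.
by rewrite /= qE -[D](subrK d) addrC; apply: hyperplaneD.
Qed.

(** * Planes in space *)

Definition coeffs (R : realType) (a b c : R) : 'I_3 -> R :=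
  fun i => [:: a; b; c]`_i.

Lemma sum_ord3 (V : nmodType) (F : 'I_3 -> V) : \sum_i F i = F 0 + F 1 + F 2.
Proof.
rewrite !big_ord_recl big_ord0 addr0 addrA.
by congr (_ + F _ + F _); apply: val_inj.
Qed.

Lemma planeE (R : realType) (a b c d : R) :
  plane a b c d = hyperplane (coeffs a b c) d.
Proof.
by apply/funext => p; rewrite /plane /hyperplane /= sum_ord3.
Qed.

Lemma forall_ord3 (Q : 'I_3 -> Prop) : (forall i, Q i) <-> [/\ Q 0, Q 1 & Q 2].
Proof.
split=> [q|[q0 q1 q2] [[|[|[|//]]] i3]]; first by [].
- by rewrite (_ : Ordinal i3 = 0) //; apply: val_inj.
- by rewrite (_ : Ordinal i3 = 1) //; apply: val_inj.
- by rewrite (_ : Ordinal i3 = 2) //; apply: val_inj.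
Qed.

(** If one side vanished, the strict inequalities would make each of the other
    two less than the other. *)
Lemma triangle_sidesE (R : realType) (a b c : R) :
  triangle_sides `|a| `|b| `|c| <-> polygon_sides (coeffs a b c).
Proof.
rewrite /polygon_sides forall_ord3.
rewrite !(big_mkcond (fun j => j != _)) /= !sum_ord3 /coeffs /= !add0r !addr0.
split=> [[_ [h1 h2 h3]] //|[h1 h2 h3]]; split=> //.
by split; rewrite gt_eqF //; lra.
Qed.

Lemma coeffs_neq0 (R : realType) (a b c : R) :
  ~ (a = 0 /\ b = 0 /\ c = 0) -> exists i, coeffs a b c i != 0.
Proof.
move=> abc; apply: contrapT => all0; apply: abc.
have z i : coeffs a b c i = 0.
  by apply/eqP; apply: contrapT => /negP ai; apply: all0; exists i.
by have := (z 0, z 1, z 2); rewrite /coeffs /= => -[[-> ->] ->].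
Qed.

(** A coefficient that dominates the others is nonzero, as they do not all
    vanish. *)
Lemma isometric_nontriangle (R : realType) (a b c d : R) :
  ~ (a = 0 /\ b = 0 /\ c = 0) -> ~ triangle_sides `|a| `|b| `|c| ->
  isometric (plane a b c d) [set: 'rV[R]_2].
Proof.
move=> /coeffs_neq0 [k ak]; rewrite triangle_sidesE planeE => /existsNP[i /negP].
rewrite -leNgt => dom; apply: (isometric_drop_coord d _ dom).
have [->//|ki] := eqVneq i k.
rewrite -normr_gt0; apply: lt_le_trans dom.
rewrite (bigD1 k) 1?eq_sym //= ltr_pwDl ?normr_gt0 //; exact: sumr_ge0.
Qed.

Unset Implicit Arguments.

Theorem corollary2 (R : realType) (a b c d : R)
    (abc_neq0 : ~ (a = 0 /\ b = 0 /\ c = 0)) :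
  (~ triangle_sides `|a| `|b| `|c| ->
     isometric (plane a b c d) [set: 'rV[R]_2] /\
     forall a' b' c' d' : R,
       ~ (a' = 0 /\ b' = 0 /\ c' = 0) ->
       ~ triangle_sides `|a'| `|b'| `|c'| ->
       isometric (plane a b c d) (plane a' b' c' d')) /\
  (triangle_sides `|a| `|b| `|c| ->
     forall a' b' c' d' : R,
       ~ (a' = 0 /\ b' = 0 /\ c' = 0) ->
       (isometric (plane a b c d) (plane a' b' c' d') <->
        exists (s : 'S_3) (e : 'I_3 -> bool) (D : R),
          plane a' b' c' d' =
          [set p | let w := signed_perm s e p in
                   a * w 0 0 + b * w 0 1 + c * w 0 2 = D])).
Proof.
split=> [nt|tri].
  have iP := isometric_nontriangle d abc_neq0 nt.
  split=> // a' b' c' d' abc' nt'; apply: isometric_trans iP _.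
  by apply: isometric_sym; exact: isometric_nontriangle.
move=> a' b' c' d' _; have [i ai] := coeffs_neq0 abc_neq0.
have setE s e D : [set p | let w := signed_perm s e p in
      a * w 0 0 + b * w 0 1 + c * w 0 2 = D] =
    signed_coords s e @^-1` hyperplane (coeffs a b c) D.
  by rewrite -planeE.
rewrite planeE; split=> [iso|[s [e [D ->]]]]; last first.
  by rewrite setE; exact: isometric_signed_coords ai.
have [p0 Pp0] := hyperplane_point d ai.
have [s [e [D PE]]] := isometric_polygonal_hyperplane
  (proj1 (triangle_sidesE a b c) tri) Pp0 iso.
by exists s, e, D; rewrite setE.
Qed.
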